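(* Consider the Fermi-Ulam model in an external gravitational field with constant acceleration $g\ge 0$, lower plate $z=f_1(t)$ and upper plate $z=f_2(t)$. Suppose $f_1,f_2$ are continuous functions, let $t^*\in\mathbb{R}$, and suppose there is an $\epsilon_1>0$ such that, for $k=1$ or $k=2$, the functions $f_1,f_2$ are $C^k$ on $(t^*-\epsilon_1,t^* )$. Assume furthermore that $f_1(t)<f_2(t)$ for $t\in(t^*-\epsilon_1,t^* )$, and that $f_i,f_i^{(1)},\dots,f_i^{(k)}$ ($i=1,2$) extend by continuity from the left to the point $t^*$. If $f_1^{(j)}(t^* )=f_2^{(j)}(t^* )$ for $j=0,1,\dots,k-1$ and $f_1^{(k)}(t^* )\ne f_2^{(k)}(t^* )$ (values at $t^*$ being the left-continuous extensions), then there exist positive constants $K,\epsilon$ such that if the initial condition $(v_0,t_0)$ satisfies $|v_0|>K$ and $t_0\in(t^*-\epsilon,t^* )$, then the ball has unbounded velocity at time $t^*$.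
   Context: Fermi-Ulam model in an external gravitational field: two infinitely heavy parallel horizontal plates move vertically, the lower one according to $z=f_1(t)$ and the upper one according to $z=f_2(t)$, where $t$ is time. A ball (point particle of zero radius) moves in the vertical direction $z$ between the plates. Between collisions it obeys Newtonian mechanics and falls toward the lower plate with constant acceleration $g\ge 0$, i.e. $\ddot z=-g$. It collides elastically with the infinitely heavy plates: at a collision with plate $i$ at time $s$, the velocity $v^-$ just before the collision is replaced by $v^+=-v^-+2\dot f_i(s)$. The plates are allowed to touch at time $t^*$, and the ball can make infinitely many collisions with both plates in a finite time interval ending at $t^*$. Denote by $v(\tau)$ the velocity of the ball at time $\tau$. The initial condition $(v_0,t_0)$ means that the ball, located between the plates, has velocity $v_0$ at time $t_0$ (if it is on a plate at time $t_0$, $v_0$ is the velocity just after the collision). Unbounded velocity at time $t^*$: the ball which has velocity $v_0$ at time $t_0<t^*$ has unbounded velocity at time $t^*$ if $\lim_{\tau\nearrow t^*}|v(\tau)|=\infty$. *)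

(* Defs.v *)
From Stdlib Require Import Reals List.
From Coquelicot Require Import Coquelicot.
Open Scope R_scope.

Definition Ck_on (k : nat) (f : R -> R) (a b : R) : Prop :=
  forall t, a < t < b ->
    forall j, (j <= k)%nat -> ex_derive_n f j t /\ continuous (Derive_n f j) t.

(* [L j] is the value at [t] of the extension of the [j]-th derivative by
   continuity from the left. *)
Definition left_extension (k : nat) (f : R -> R) (t : R) (L : nat -> R) : Prop :=
  forall j, (j <= k)%nat -> filterlim (Derive_n f j) (at_left t) (locally (L j)).

(* The velocity [v] is taken right-continuous, so [v s] is the velocity just
   after the collision and the left limit [vm] the velocity just before it. *)
Definition elastic_collision (f v : R -> R) (s : R) : Prop :=
  exists vm, filterlim v (at_left s) (locally vm) /\ v s = - vm + 2 * Derive f s.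

(* On a plate, a velocity just after a collision does not point into it. *)
Definition admissible_initial (f1 f2 : R -> R) (t0 z0 v0 : R) : Prop :=
  f1 t0 <= z0 <= f2 t0 /\
  (z0 = f1 t0 -> Derive f1 t0 <= v0) /\
  (z0 = f2 t0 -> v0 <= Derive f2 t0).

(* Position [z] and velocity [v] of the ball on the time interval [[t0, T)].
   Collisions are isolated events before [T], but may accumulate at [T]. *)
Record ball_motion (f1 f2 : R -> R) (g T t0 z0 v0 : R) (z v : R -> R) : Prop := {
  motion_init : z t0 = z0 /\ v t0 = v0;
  motion_between : forall t, t0 <= t < T -> f1 t <= z t <= f2 t;
  motion_z_right : forall t, t0 <= t < T -> filterlim z (at_right t) (locally (z t));
  motion_z_left : forall t, t0 < t < T -> filterlim z (at_left t) (locally (z t));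
  motion_v_right : forall t, t0 <= t < T -> filterlim v (at_right t) (locally (v t));
  motion_flight : forall t, t0 < t < T -> f1 t < z t < f2 t ->
    is_derive z t (v t) /\ is_derive v t (- g);
  motion_lower : forall s, t0 < s < T -> z s = f1 s -> elastic_collision f1 v s;
  motion_upper : forall s, t0 < s < T -> z s = f2 s -> elastic_collision f2 v s;
  motion_isolated : forall T', T' < T ->
    exists l : list R, forall s, t0 <= s <= T' -> z s = f1 s \/ z s = f2 s -> In s l
}.

(* The first conjunct says that the motion does continue up to time [T]; it
   keeps the second one from holding vacuously. *)
Definition unbounded_velocity (f1 f2 : R -> R) (g T t0 z0 v0 : R) : Prop :=
  (exists z v, ball_motion f1 f2 g T t0 z0 v0 z v) /\
  (forall z v, ball_motion f1 f2 g T t0 z0 v0 z v ->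
     filterlim (fun t => Rabs (v t)) (at_left T) (Rbar_locally p_infty)).

(* Main.v *)
Require Import Defs.
From Stdlib Require Import Reals Arith List Lra Lia ClassicalEpsilon.
From Coquelicot Require Import Coquelicot.
Open Scope R_scope.


(** The gap h = f2 - f1 closes at T, and the ball gains speed by bouncing
    between the approaching plates; the proof follows one quantity that records
    this gain and depends only on the current state of the ball.

    Take barriers a1 > a2 with f1' >= a1 and a2 >= f2' just before T.  For k = 1
    they are constants strictly between the two distinct limits of f1' and f2';
    for k = 2 they are f1' and f2' themselves.  In both cases the a_i are C^1
    with bounded derivative, and h <= C (T - t) (a1 - a2), because h has order
    (T - t)^k and a1 - a2 has order (T - t)^(k-1) ([closing_plates_order1],
    [closing_plates_order2]).  The rest of the proof uses only these properties
    ([closing_plates]).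

    Let w be the velocity of the ball relative to the linear interpolation of
    the barriers between the plates:
      w = v - (a1 + y (a2 - a1)),  y = (z - f1) / h.
    At a collision y is 0 or 1.  If f_i' were equal to a_i, the law
    v+ = - v- + 2 f_i' would turn w into - w; since f1' >= a1 and f2' <= a2, |w|
    can only increase ([collision_gain]).  In free flight
      w' = (v - (1 - y) f1' - y f2') (a1 - a2) / h + bounded terms,
    and (a1 - a2) / h >= 1 / (C (T - t)), so that |w| >= threshold implies
    |w|' >= 1 / (T - t) ([rel_flight]).  Hence |w| + ln (T - t) is nondecreasing
    along every motion that starts above the threshold ([rel_growth]); since
    |w - v| is bounded, |v| tends to infinity ([speed_unbounded]).

    A motion up to T exists because a fast ball moving towards a plate must
    meet it before T: it leaves the other plate behind, and the two plates meet
    at T ([next_event_exists]).  The resulting flights have no limit time before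
    T: there the gap is bounded below, while each collision adds only a bounded
    amount to the speed ([bounce_times_unbounded]).  Gluing them gives the
    motion ([glued_motion]). *)

(** * One-sided limits and monotonicity *)

Lemma at_left_iff (s : R) (P : R -> Prop) :
  at_left s P <-> exists d, 0 < d /\ forall x, s - d < x < s -> P x.
Proof.
  split.
  - intros [d Hd]; exists d; split; [apply cond_pos|].
    intros x Hx; apply Hd; [|lra].
    change (Rabs (x - s) < d); apply Rabs_lt_between; lra.
  - intros [d [Hd H]]; exists (mkposreal d Hd); intros x Hx Hxs; apply H.
    change (Rabs (x - s) < d) in Hx; apply Rabs_lt_between in Hx; lra.
Qed.

Lemma at_right_iff (s : R) (P : R -> Prop) :
  at_right s P <-> exists d, 0 < d /\ forall x, s < x < s + d -> P x.
Proof.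
  split.
  - intros [d Hd]; exists d; split; [apply cond_pos|].
    intros x Hx; apply Hd; [|lra].
    change (Rabs (x - s) < d); apply Rabs_lt_between; lra.
  - intros [d [Hd H]]; exists (mkposreal d Hd); intros x Hx Hxs; apply H.
    change (Rabs (x - s) < d) in Hx; apply Rabs_lt_between in Hx; lra.
Qed.

Lemma continuous_at_left (f : R -> R) (s : R) :
  continuous f s -> filterlim f (at_left s) (locally (f s)).
Proof.
  intros H; apply filterlim_filter_le_1 with (2 := H).
  apply filter_le_within; typeclasses eauto.
Qed.

Lemma continuous_at_right (f : R -> R) (s : R) :
  continuous f s -> filterlim f (at_right s) (locally (f s)).
Proof.
  intros H; apply filterlim_filter_le_1 with (2 := H).
  apply filter_le_within; typeclasses eauto.
Qed.

Lemma rlim_plus (F : (R -> Prop) -> Prop) {FF : Filter F} (f g : R -> R) (a b : R) :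
  filterlim f F (locally a) -> filterlim g F (locally b) ->
  filterlim (fun x => f x + g x) F (locally (a + b)).
Proof.
  intros Hf Hg; apply (filterlim_comp_2 f g Rplus Hf Hg (filterlim_plus a b)).
Qed.

Lemma rlim_scal (F : (R -> Prop) -> Prop) {FF : Filter F} (c : R) (f : R -> R) (a : R) :
  filterlim f F (locally a) ->
  filterlim (fun x => c * f x) F (locally (c * a)).
Proof.
  intros Hf; apply (filterlim_comp _ _ _ f (Rmult c) _ _ _ Hf (filterlim_scal_r c a)).
Qed.

Lemma rlim_mult (F : (R -> Prop) -> Prop) {FF : Filter F} (f g : R -> R) (a b : R) :
  filterlim f F (locally a) -> filterlim g F (locally b) ->
  filterlim (fun x => f x * g x) F (locally (a * b)).
Proof.
  intros Hf Hg; apply (filterlim_comp_2 f g Rmult Hf Hg (filterlim_mult a b)).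
Qed.

Lemma rlim_minus (F : (R -> Prop) -> Prop) {FF : Filter F} (f g : R -> R) (a b : R) :
  filterlim f F (locally a) -> filterlim g F (locally b) ->
  filterlim (fun x => f x - g x) F (locally (a - b)).
Proof.
  intros Hf Hg; apply rlim_plus; [easy|easy|].
  apply (filterlim_comp _ _ _ g Ropp _ _ _ Hg (filterlim_opp b)).
Qed.

Lemma rlim_inv (F : (R -> Prop) -> Prop) {FF : Filter F} (f : R -> R) (a : R) :
  filterlim f F (locally a) -> a <> 0 ->
  filterlim (fun x => / f x) F (locally (/ a)).
Proof.
  intros Hf Ha; apply (filterlim_comp _ _ _ f Rinv _ _ _ Hf).
  now apply continuous_Rinv.
Qed.

Lemma rlim_abs (F : (R -> Prop) -> Prop) {FF : Filter F} (f : R -> R) (a : R) :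
  filterlim f F (locally a) ->
  filterlim (fun x => Rabs (f x)) F (locally (Rabs a)).
Proof.
  intros Hf; apply (filterlim_comp _ _ _ f Rabs _ _ _ Hf).
  apply (continuous_Rabs a).
Qed.

Lemma rlim_le (F : (R -> Prop) -> Prop) {FF : ProperFilter F} (f g : R -> R) (a b : R) :
  filterlim f F (locally a) -> filterlim g F (locally b) ->
  F (fun x => f x <= g x) -> a <= b.
Proof.
  intros Hf Hg H; exact (filterlim_le (F := F) f g a b H Hf Hg).
Qed.

Lemma rlim_eventually_gt (F : (R -> Prop) -> Prop) {FF : Filter F} (f : R -> R) (a c : R) :
  filterlim f F (locally a) -> c < a -> F (fun x => c < f x).
Proof. intros Hf Hc; apply Hf; now apply (open_gt c). Qed.

Lemma nondecreasing_of_derive (f : R -> R) (a b : R) :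
  (forall x, a < x < b -> exists d, is_derive f x d /\ 0 <= d) ->
  forall x y, a < x -> x <= y -> y < b -> f x <= f y.
Proof.
  intros H x y Hx Hxy Hy.
  destruct (MVT_gen f x y (Derive f)) as [c [Hc E]].
  - intros u; rewrite Rmin_left, Rmax_right by lra; intros Hu.
    destruct (H u) as [d [Hd _]]; [lra|].
    apply Derive_correct; now exists d.
  - intros u; rewrite Rmin_left, Rmax_right by lra; intros Hu.
    destruct (H u) as [d [Hd _]]; [lra|].
    apply continuity_pt_filterlim, (ex_derive_continuous f); now exists d.
  - rewrite Rmin_left, Rmax_right in Hc by lra.
    destruct (H c) as [d [Hd D0]]; [lra|].
    rewrite (is_derive_unique _ _ _ Hd) in E; nra.
Qed.

Lemma le_left_limit (f : R -> R) (a b l : R) :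
  (forall x, a < x < b -> exists d, is_derive f x d /\ 0 <= d) ->
  filterlim f (at_left b) (locally l) ->
  forall x, a < x < b -> f x <= l.
Proof.
  intros H Hl x Hx.
  apply (rlim_le (at_left b) (fun _ => f x) f); [apply filterlim_const|easy|].
  apply at_left_iff; exists (b - x); split; [lra|]; intros y Hy.
  apply (nondecreasing_of_derive f a b H); lra.
Qed.

Lemma right_limit_le (f : R -> R) (a b l : R) :
  (forall x, a < x < b -> exists d, is_derive f x d /\ 0 <= d) ->
  filterlim f (at_right a) (locally l) ->
  forall x, a < x < b -> l <= f x.
Proof.
  intros H Hl x Hx.
  apply (rlim_le (at_right a) f (fun _ => f x)); [easy|apply filterlim_const|].
  apply at_right_iff; exists (x - a); split; [lra|]; intros y Hy.
  apply (nondecreasing_of_derive f a b H); lra.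
Qed.

(** This replaces an induction on successive collisions: an arbitrary motion comes
    without an enumeration of them, but each time has a collision-free
    neighbourhood on either side. *)
Lemma real_induction (P : R -> Prop) (a b : R) :
  P a ->
  (forall s, a <= s < b -> (forall x, a <= x <= s -> P x) ->
     exists d, 0 < d /\ forall x, s < x < s + d -> P x) ->
  (forall s, a < s < b -> (forall x, a <= x < s -> P x) -> P s) ->
  forall t, a <= t < b -> P t.
Proof.
  intros Pa Hr Hl t Ht.
  set (E := fun s => a <= s <= t /\ forall x, a <= x <= s -> P x).
  destruct (completeness E) as [m [Hub Hlub]].
  - exists t; intros s [Hs _]; lra.
  - exists a; split; [lra|]; intros x Hx; now replace x with a by lra.
  - assert (Ham : a <= m).
    { apply Hub; split; [lra|]; intros x Hx; now replace x with a by lra. }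
    assert (Hmt : m <= t) by (apply Hlub; intros s [Hs _]; lra).
    assert (Hbelow : forall x, a <= x < m -> P x).
    { intros x Hx; destruct (classic (P x)) as [|N]; [easy|].
      exfalso; assert (m <= x); [|lra].
      apply Hlub; intros s [Hs Ps]; destruct (Rle_lt_dec s x); [easy|].
      exfalso; apply N, Ps; lra. }
    assert (Hm : forall x, a <= x <= m -> P x).
    { intros x Hx; destruct (Rle_lt_dec m x); [|apply Hbelow; lra].
      replace x with m by lra.
      destruct (Rle_lt_dec m a); [now replace m with a by lra|].
      apply Hl; [lra|easy]. }
    destruct (Rle_lt_dec t m); [apply Hm; lra|].
    destruct (Hr m) as [d [Hd Hd']]; [lra|easy|].
    exfalso.
    set (s := Rmin t (m + d / 2)).
    assert (m < s) by (apply Rmin_glb_lt; lra).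
    assert (s <= m); [|lra].
    assert (s <= t) by apply Rmin_l.
    assert (s <= m + d / 2) by apply Rmin_r.
    apply Hub; split; [lra|]; intros x Hx.
    destruct (Rle_lt_dec x m); [apply Hm; lra|apply Hd'; lra].
Qed.

Lemma list_isolated (l : list R) (s : R) :
  exists d, 0 < d /\ forall x, s - d < x < s + d -> x <> s -> ~ In x l.
Proof.
  induction l as [|y l [d [Hd IH]]].
  - exists 1; split; [lra|]; intros x _ _ [].
  - destruct (Req_dec y s) as [->|Hy].
    + exists d; split; [easy|]; intros x Hx Hxs [E|I]; [now apply Hxs|].
      now apply (IH x).
    + assert (Hp : 0 < Rabs (y - s)) by (apply Rabs_pos_lt; lra).
      exists (Rmin d (Rabs (y - s))); split; [now apply Rmin_glb_lt|].
      intros x Hx Hxs.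
      assert (Rmin d (Rabs (y - s)) <= d) by apply Rmin_l.
      assert (Rmin d (Rabs (y - s)) <= Rabs (y - s)) by apply Rmin_r.
      intros [<-|I]; [|apply (IH x); [lra|easy|easy]].
      revert H0; unfold Rabs at 2; destruct (Rcase_abs (y - s)); lra.
Qed.

(** * The velocity relative to the barriers *)

(** The common form of the two cases k = 1 and k = 2.  Plates and barriers are
    indexed by a boolean, [false] for the lower plate and [true] for the upper
    one, so that upward and downward flights are treated together. *)
Record closing_plates (f a : bool -> R -> R) (e T M C : R) : Prop := {
  window : 0 < e <= 1;
  M_ge0 : 0 <= M;
  C_gt0 : 0 < C;
  plate_cont : forall b t, continuous (f b) t;
  plates_meet : f false T = f true T;
  gap_gt0 : forall t, T - e < t < T -> f false t < f true t;
  plate_diff : forall b t, T - e < t < T ->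
    ex_derive (f b) t /\ Rabs (Derive (f b) t) <= M;
  barrier_diff : forall b t, T - e < t < T ->
    ex_derive (a b) t /\ Rabs (a b t) <= M /\ Rabs (Derive (a b) t) <= M;
  barrier_lower : forall t, T - e < t < T -> a false t <= Derive (f false) t;
  barrier_upper : forall t, T - e < t < T -> Derive (f true) t <= a true t;
  gap_le : forall t, T - e < t < T ->
    f true t - f false t <= C * (T - t) * (a false t - a true t)
}.

(** Sign of the direction towards plate [b]. *)
Definition sg (b : bool) : R := if b then 1 else -1.

(** The Lyapunov quantity: velocity relative to the velocity field that equals
    the barrier values on the plates and is affine in the height between them. *)
Definition rel (f a : bool -> R -> R) (t z v : R) : R :=
  v - (a false t + (z - f false t) / (f true t - f false t) * (a true t - a false t)).

(** The term with [C] makes the compression term of the acceleration, which is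
    at least (|w| - 2 M) / (C (T - t)) in size, exceed gravity and the drift of
    the barriers by 1 / (T - t); the remaining terms keep the velocity, after
    the loss |g| that gravity can cause during a flight, larger than any plate
    velocity by at least 1. *)
Definition threshold (g M C : R) : R := 2 * M + Rabs g + 1 + C * (1 + Rabs g + M).

Lemma threshold_gt (g M C : R) : 0 <= M -> 0 < C -> 2 * M + Rabs g + 1 < threshold g M C.
Proof.
  intros HM HC; unfold threshold.
  assert (0 <= Rabs g) by apply Rabs_pos; nra.
Qed.

Lemma sg_abs (x : R) : exists b, sg b * x = Rabs x.
Proof.
  destruct (Rle_lt_dec 0 x).
  - exists true; rewrite Rabs_pos_eq by lra; simpl; lra.
  - exists false; rewrite Rabs_left by lra; simpl; lra.
Qed.

Lemma sg_le_abs (b : bool) (x : R) : sg b * x <= Rabs x.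
Proof. destruct b; simpl; unfold Rabs; destruct (Rcase_abs x); lra. Qed.

Lemma convex_le (y p q M : R) :
  0 <= y <= 1 -> p <= M -> q <= M -> (1 - y) * p + y * q <= M.
Proof. intros; nra. Qed.

Lemma convex_ge (y p q M : R) :
  0 <= y <= 1 -> - M <= p -> - M <= q -> - M <= (1 - y) * p + y * q.
Proof. intros; nra. Qed.

Lemma ratio_01 (l z u : R) : l < u -> l <= z <= u -> 0 <= (z - l) / (u - l) <= 1.
Proof.
  intros H Hz; split.
  - apply Rmult_le_pos; [lra|]; left; apply Rinv_0_lt_compat; lra.
  - apply Rmult_le_reg_r with (u - l); [lra|].
    unfold Rdiv; rewrite Rmult_assoc, Rinv_l; lra.
Qed.

Lemma rel_close (f a : bool -> R -> R) (e T M C t z v : R) :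
  closing_plates f a e T M C -> T - e < t < T -> f false t <= z <= f true t ->
  Rabs (rel f a t z v - v) <= M.
Proof.
  intros CP Ht Hz.
  assert (G := gap_gt0 _ _ _ _ _ _ CP t Ht).
  destruct (barrier_diff _ _ _ _ _ _ CP false t Ht) as [_ [A0 _]].
  destruct (barrier_diff _ _ _ _ _ _ CP true t Ht) as [_ [A1 _]].
  apply Rabs_le_between in A0, A1.
  assert (Y := ratio_01 _ _ _ G Hz); unfold rel.
  set (y := (z - f false t) / (f true t - f false t)) in *.
  assert (U := convex_le y (a false t) (a true t) M Y (proj2 A0) (proj2 A1)).
  assert (L := convex_ge y (a false t) (a true t) M Y (proj1 A0) (proj1 A1)).
  apply Rabs_le_between; lra.
Qed.

Lemma rel_on_plate (f a : bool -> R -> R) (e T M C t v : R) (b : bool) :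
  closing_plates f a e T M C -> T - e < t < T ->
  rel f a t (f b t) v = v - a b t.
Proof.
  intros CP Ht; assert (G := gap_gt0 _ _ _ _ _ _ CP t Ht).
  unfold rel; destruct b; field; lra.
Qed.

(** Compression of the gap acts on the relative velocity as a negative friction
    of rate (a1 - a2) / h, which dominates gravity and the drift of the barriers
    above the threshold. *)
Lemma rel_flight (f a : bool -> R -> R) (e T M C g t : R) (z v : R -> R) (b : bool) :
  closing_plates f a e T M C -> T - e < t < T ->
  f false t < z t < f true t ->
  is_derive z t (v t) -> is_derive v t (- g) ->
  threshold g M C <= sg b * rel f a t (z t) (v t) ->
  exists d, is_derive (fun x => rel f a x (z x) (v x)) t d /\ / (T - t) <= sg b * d.
Proof.
  intros CP Ht Hz Dz Dv Hrel.
  assert (G := gap_gt0 _ _ _ _ _ _ CP t Ht).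
  assert (GL := gap_le _ _ _ _ _ _ CP t Ht).
  assert (HC := C_gt0 _ _ _ _ _ _ CP).
  assert (HM := M_ge0 _ _ _ _ _ _ CP).
  assert (HW := window _ _ _ _ _ _ CP).
  destruct (barrier_diff _ _ _ _ _ _ CP false t Ht) as [XA0 [_ A0]].
  destruct (barrier_diff _ _ _ _ _ _ CP true t Ht) as [XA1 [_ A1]].
  destruct (plate_diff _ _ _ _ _ _ CP false t Ht) as [XF0 F0].
  destruct (plate_diff _ _ _ _ _ _ CP true t Ht) as [XF1 F1].
  apply Rabs_le_between in A0, A1, F0, F1.
  assert (RC := rel_close f a e T M C t (z t) (v t) CP Ht ltac:(lra)).
  apply Rabs_le_between in RC.
  assert (Y : 0 <= (z t - f false t) / (f true t - f false t) <= 1)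
    by (apply ratio_01; lra).
  set (y := (z t - f false t) / (f true t - f false t)) in *.
  set (q := (a false t - a true t) / (f true t - f false t)).
  set (ca := (1 - y) * Derive (a false) t + y * Derive (a true) t).
  set (cf := (1 - y) * Derive (f false) t + y * Derive (f true) t).
  assert (Uca := convex_le y _ _ M Y (proj2 A0) (proj2 A1)); fold ca in Uca.
  assert (Lca := convex_ge y _ _ M Y (proj1 A0) (proj1 A1)); fold ca in Lca.
  assert (Ucf := convex_le y _ _ M Y (proj2 F0) (proj2 F1)); fold cf in Ucf.
  assert (Lcf := convex_ge y _ _ M Y (proj1 F0) (proj1 F1)); fold cf in Lcf.
  (* The derivative of y is (v - cf) / h, which multiplies a2 - a1. *)
  exists (- g - ca + (v t - cf) * q); split.
  - unfold rel.
    assert (Xz : ex_derive z t) by (now exists (v t)).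
    assert (Xv : ex_derive v t) by (now exists (- g)).
    auto_derive.
    + repeat split; try assumption; lra.
    + rewrite (is_derive_unique _ _ _ Dz : Derive (fun x => z x) t = v t),
        (is_derive_unique _ _ _ Dv : Derive (fun x => v x) t = - g).
      change (Derive (fun x => f false x) t) with (Derive (f false) t).
      change (Derive (fun x => f true x) t) with (Derive (f true) t).
      change (Derive (fun x => a false x) t) with (Derive (a false) t).
      change (Derive (fun x => a true x) t) with (Derive (a true) t).
      unfold ca, cf, q, y; field; lra.
  - assert (Hq : / (C * (T - t)) <= q).
    { apply Rmult_le_reg_r with (C * (T - t) * (f true t - f false t)).
      - repeat apply Rmult_lt_0_compat; lra.
      - unfold q; field_simplify; try lra; nra. }
    assert (Hp : 0 < / (C * (T - t)))
      by (apply Rinv_0_lt_compat; apply Rmult_lt_0_compat; lra).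
    assert (Htau : 1 <= / (T - t)).
    { rewrite <- Rinv_1; apply Rinv_le_contravar; lra. }
    assert (Hg := Rle_abs g); assert (Hg' := Rle_abs (- g)); rewrite Rabs_Ropp in Hg'.
    assert (Big : C * (1 + Rabs g + M) <= sg b * (v t - cf)).
    { unfold threshold in Hrel; destruct b; unfold sg in *; lra. }
    assert (Prod : (1 + Rabs g + M) * / (T - t) <= sg b * (v t - cf) * q).
    { replace ((1 + Rabs g + M) * / (T - t))
        with (C * (1 + Rabs g + M) * / (C * (T - t))) by (field; lra).
      assert (0 < C * (1 + Rabs g + M)) by (apply Rmult_lt_0_compat; lra).
      apply Rmult_le_compat; lra. }
    assert (Rabs g + M <= (Rabs g + M) * / (T - t)) by nra.
    assert (- (Rabs g + M) <= sg b * (- g - ca)) by (destruct b; simpl; lra).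
    nra.
Qed.

(** Stated for a filter finer than the neighbourhoods of [s], to serve for limits
    on the left and on the right. *)
Lemma rel_limit (f a : bool -> R -> R) (e T M C s zl vl : R) (z v : R -> R)
  (F : (R -> Prop) -> Prop) {FF : Filter F} :
  closing_plates f a e T M C -> T - e < s < T ->
  (forall h : R -> R, continuous h s -> filterlim h F (locally (h s))) ->
  filterlim z F (locally zl) -> filterlim v F (locally vl) ->
  filterlim (fun x => rel f a x (z x) (v x)) F (locally (rel f a s zl vl)).
Proof.
  intros CP Hs HF Hz Hv.
  assert (G := gap_gt0 _ _ _ _ _ _ CP s Hs).
  assert (Lf : forall b, filterlim (f b) F (locally (f b s))).
  { intros b; apply HF, (plate_cont _ _ _ _ _ _ CP). }
  assert (La : forall b, filterlim (a b) F (locally (a b s))).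
  { intros b; apply HF, (ex_derive_continuous (a b)), (barrier_diff _ _ _ _ _ _ CP b s Hs). }
  unfold rel, Rdiv.
  repeat first [assumption | apply Lf | apply La | apply rlim_minus | apply rlim_plus
    | apply rlim_mult | apply rlim_inv]; lra.
Qed.

(** If w is the left limit of the relative velocity at a collision with plate
    [b], the relative velocity afterwards is - w + 2 (f_b' - a_b), and the barrier
    inequality says that the last term points away from the plate.  So |w| cannot
    drop, provided that w pointed into the plate; it did, because a fast ball
    moving away from the plate cannot be reaching it. *)
Lemma collision_gain (f a : bool -> R -> R) (e T M C g s r : R) (z v : R -> R) (b : bool) :
  closing_plates f a e T M C -> T - e < r -> r < s < T ->
  (forall x, r < x < s -> f false x < z x < f true x /\ is_derive z x (v x) /\
     threshold g M C <= Rabs (rel f a x (z x) (v x))) ->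
  filterlim z (at_left s) (locally (z s)) -> z s = f b s ->
  elastic_collision (f b) v s ->
  exists w, filterlim (fun x => rel f a x (z x) (v x)) (at_left s) (locally w) /\
    Rabs w <= Rabs (rel f a s (z s) (v s)).
Proof.
  intros CP Hr Hs Hfl Hz Eb [vm [Hvm Ev]].
  assert (Hs' : T - e < s < T) by lra.
  assert (HC := C_gt0 _ _ _ _ _ _ CP).
  assert (HM := M_ge0 _ _ _ _ _ _ CP).
  assert (Thr := threshold_gt g M C HM HC).
  assert (Hg := Rabs_pos g).
  assert (Lw := rel_limit f a e T M C s (z s) vm z v (at_left s) CP Hs'
    (fun h => continuous_at_left h s) Hz Hvm).
  exists (rel f a s (z s) vm); split; [exact Lw|].
  rewrite Eb in Lw |- *.
  rewrite !(rel_on_plate f a e T M C) in * by assumption.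
  (* Otherwise the distance to the plate would grow on the left of s and yet
     tend to 0. *)
  assert (Hw : 0 <= sg b * (vm - a b s)).
  { apply Rnot_lt_le; intros N.
    assert (Ev1 : at_left s (fun x => 0 < - sg b * rel f a x (z x) (v x))).
    { apply (rlim_eventually_gt _ _ (- sg b * (vm - a b s))); [|lra].
      now apply rlim_scal; [typeclasses eauto|]. }
    apply at_left_iff in Ev1; destruct Ev1 as [d [Hd Ev1]].
    set (r' := Rmax r (s - d)).
    assert (r <= r') by apply Rmax_l.
    assert (s - d <= r') by apply Rmax_r.
    assert (r' < s) by (apply Rmax_lub_lt; lra).
    set (x := (r' + s) / 2).
    assert (Hx : r' < x < s) by (unfold x; lra).
    assert (- sg b * (z x - f b x) <= - sg b * (z s - f b s)) as Hle.
    { apply (le_left_limit (fun x => - sg b * (z x - f b x)) r' s).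
      - intros u Hu; destruct (Hfl u) as [Bu [Du Ru]]; [lra|].
        destruct (plate_diff _ _ _ _ _ _ CP b u) as [Xu Fu]; [lra|].
        exists (- sg b * (v u - Derive (f b) u)); split.
        + assert (ex_derive z u) by (now exists (v u)).
          auto_derive; [now repeat split|].
          rewrite (is_derive_unique _ _ _ Du : Derive (fun x => z x) u = v u).
          change (Derive (fun x => f b x) u) with (Derive (f b) u); ring.
        + assert (RC := rel_close f a e T M C u (z u) (v u) CP ltac:(lra) ltac:(lra)).
          specialize (Ev1 u ltac:(lra)).
          apply Rabs_le_between in RC, Fu.
          assert (sg b * rel f a u (z u) (v u) <= - threshold g M C).
          { revert Ru; unfold Rabs; destruct Rcase_abs; destruct b; unfold sg in *; lra. }
          destruct b; unfold sg in *; lra.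
      - apply rlim_scal; [typeclasses eauto|]; apply rlim_minus; [typeclasses eauto|easy|].
        apply continuous_at_left, (plate_cont _ _ _ _ _ _ CP).
      - lra. }
    rewrite Eb in Hle; destruct (Hfl x) as [Bx _]; [lra|].
    destruct b; unfold sg in *; lra. }
  rewrite Ev.
  assert (B0 := barrier_lower _ _ _ _ _ _ CP s Hs').
  assert (B1 := barrier_upper _ _ _ _ _ _ CP s Hs').
  apply Rle_trans with (sg b * (vm - a b s)).
  - right; unfold Rabs; destruct Rcase_abs; destruct b; unfold sg in *; lra.
  - apply Rle_trans with (sg (negb b) * (- vm + 2 * Derive (f b) s - a b s));
      [|apply sg_le_abs].
    destruct b; unfold sg in *; simpl; lra.
Qed.

(** * Growth along an arbitrary motion *)

Lemma collision_free_near (f1 f2 : R -> R) (g T t0 z0 v0 s : R) (z v : R -> R) :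
  ball_motion f1 f2 g T t0 z0 v0 z v -> t0 <= s < T ->
  exists d, 0 < d /\ forall x, s - d < x < s + d -> x <> s -> t0 < x ->
    x < T /\ f1 x < z x < f2 x /\ is_derive z x (v x) /\ is_derive v x (- g).
Proof.
  intros B Hs.
  destruct (motion_isolated _ _ _ _ _ _ _ _ _ B ((s + T) / 2)) as [l Hl]; [lra|].
  destruct (list_isolated l s) as [d [Hd H]].
  set (d' := Rmin d ((T - s) / 2)).
  assert (d' <= d) by apply Rmin_l.
  assert (d' <= (T - s) / 2) by apply Rmin_r.
  exists d'; split; [apply Rmin_glb_lt; lra|].
  intros x Hx Hxs Hx0.
  assert (NI : ~ In x l) by (apply H; [lra|easy]).
  assert (Bt := motion_between _ _ _ _ _ _ _ _ _ B x ltac:(lra)).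
  assert (Fl : f1 x < z x < f2 x).
  { destruct (Req_dec (z x) (f1 x)); [exfalso; apply NI, Hl; [lra|now left]|].
    destruct (Req_dec (z x) (f2 x)); [exfalso; apply NI, Hl; [lra|now right]|]. lra. }
  split; [lra|split; [easy|]].
  apply (motion_flight _ _ _ _ _ _ _ _ _ B); [lra|easy].
Qed.

Lemma is_derive_log_gap (T t : R) : t < T -> is_derive (fun x => ln (T - x)) t (- / (T - t)).
Proof. intros H; auto_derive; [lra|field; lra]. Qed.

(** The bound propagates by [real_induction]: to the right of a point through the
    flight estimate, and through a collision by [collision_gain].  The bound
    itself keeps the relative speed above the threshold, which both estimates
    need.  The end [T1] may precede [T], so that the theorem also applies to a
    single flight. *)
Theorem rel_growth (f a : bool -> R -> R) (e T M C g T1 t0 z0 v0 : R) (z v : R -> R) :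
  closing_plates f a e T M C -> T - e < t0 -> T1 <= T ->
  ball_motion (f false) (f true) g T1 t0 z0 v0 z v ->
  threshold g M C < Rabs (rel f a t0 z0 v0) ->
  forall t, t0 <= t < T1 ->
    Rabs (rel f a t0 z0 v0) + ln (T - t0) <= Rabs (rel f a t (z t) (v t)) + ln (T - t).
Proof.
  intros CP Ht0 HT1 B Hthr.
  destruct (motion_init _ _ _ _ _ _ _ _ _ B) as [Ez Ev].
  set (w := fun x => rel f a x (z x) (v x)).
  assert (Big : forall x, t0 <= x < T1 ->
    Rabs (rel f a t0 z0 v0) + ln (T - t0) <= Rabs (w x) + ln (T - x) ->
    threshold g M C < Rabs (w x)).
  { intros x Hx Hw.
    assert (ln (T - x) <= ln (T - t0)); [apply ln_le; lra|]. lra. }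
  apply (real_induction
    (fun t => Rabs (rel f a t0 z0 v0) + ln (T - t0) <= Rabs (w t) + ln (T - t)) t0 T1).
  - unfold w; rewrite Ez, Ev; lra.
  - intros s Hs IH.
    assert (Ws := Big s Hs (IH s ltac:(lra))).
    destruct (sg_abs (w s)) as [b Eb].
    assert (Lw : filterlim w (at_right s) (locally (w s))).
    { apply (rel_limit f a e T M C); [typeclasses eauto|easy|lra| | |].
      - intros h; apply continuous_at_right.
      - now apply (motion_z_right _ _ _ _ _ _ _ _ _ B).
      - now apply (motion_v_right _ _ _ _ _ _ _ _ _ B). }
    assert (Ev1 : at_right s (fun x => threshold g M C < sg b * w x)).
    { apply (rlim_eventually_gt _ _ (sg b * w s)); [|lra].
      now apply rlim_scal; [typeclasses eauto|]. }
    apply at_right_iff in Ev1; destruct Ev1 as [d1 [Hd1 Ev1]].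
    destruct (collision_free_near _ _ _ _ _ _ _ s _ _ B Hs) as [d2 [Hd2 Fr]].
    set (d := Rmin d1 d2).
    assert (d <= d1) by apply Rmin_l.
    assert (d <= d2) by apply Rmin_r.
    assert (Hd : 0 < d) by (now apply Rmin_glb_lt).
    exists d; split; [easy|]; intros x Hx.
    apply Rle_trans with (Rabs (w s) + ln (T - s)); [apply IH; lra|].
    apply Rle_trans with (sg b * w x + ln (T - x));
      [|apply Rplus_le_compat_r, sg_le_abs].
    apply (right_limit_le (fun x => sg b * w x + ln (T - x)) s (s + d)); [|rewrite <- Eb|easy].
    + intros y Hy; destruct (Fr y) as [HyT [Fy [Dz Dv]]]; [lra|lra|lra|].
      destruct (rel_flight f a e T M C g y z v b CP) as [D [HD HD']];
        [lra|lra|easy|easy|left; apply Ev1; lra|].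
      exists (sg b * D + - / (T - y)); split; [|lra].
      apply (is_derive_plus (fun x => sg b * w x) (fun x => ln (T - x))).
      * now apply (is_derive_scal w).
      * apply is_derive_log_gap; lra.
    + apply (rlim_plus (at_right s) (fun x => sg b * w x) (fun x => ln (T - x))).
      * now apply rlim_scal; [typeclasses eauto|].
      * apply (continuous_at_right (fun x => ln (T - x))), (ex_derive_continuous (fun x => ln (T - x))).
        eexists; apply is_derive_log_gap; lra.
  - intros s Hs IH.
    assert (Lim : exists l, filterlim w (at_left s) (locally l) /\ Rabs l <= Rabs (w s)).
    { destruct (collision_free_near _ _ _ _ _ _ _ s _ _ B ltac:(lra)) as [d [Hd Fr]].
      set (r := Rmax t0 (s - d)).
      assert (t0 <= r) by apply Rmax_l.
      assert (s - d <= r) by apply Rmax_r.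
      assert (r < s) by (apply Rmax_lub_lt; lra).
      assert (Hcol : forall b, z s = f b s -> elastic_collision (f b) v s ->
        exists l, filterlim w (at_left s) (locally l) /\ Rabs l <= Rabs (w s)).
      { intros b Hb Hel.
        apply (collision_gain f a e T M C g s ((r + s) / 2) z v b);
          [easy|lra|lra| | |easy|easy].
        - intros x Hx; destruct (Fr x) as [HxT [Fx [Dz _]]]; [lra|lra|lra|].
          split; [easy|split; [easy|]].
          left; apply Big; [lra|]; apply IH; lra.
        - now apply (motion_z_left _ _ _ _ _ _ _ _ _ B). }
      destruct (motion_between _ _ _ _ _ _ _ _ _ B s ltac:(lra)) as [Hlo Hhi].
      destruct (Req_dec (z s) (f false s)) as [E|N0].
      { apply (Hcol false E), (motion_lower _ _ _ _ _ _ _ _ _ B); easy. }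
      destruct (Req_dec (z s) (f true s)) as [E|N1].
      { apply (Hcol true E), (motion_upper _ _ _ _ _ _ _ _ _ B); easy. }
      destruct (motion_flight _ _ _ _ _ _ _ _ _ B s Hs ltac:(lra)) as [Dz Dv].
      exists (w s); split; [|lra].
      apply (rel_limit f a e T M C); [typeclasses eauto|easy|lra| | |].
      - intros h; apply continuous_at_left.
      - apply continuous_at_left, (ex_derive_continuous z); now exists (v s).
      - apply continuous_at_left, (ex_derive_continuous v); now exists (- g). }
    destruct Lim as [l [Ll Hl]].
    apply Rle_trans with (Rabs l + ln (T - s)); [|lra].
    apply (rlim_le (at_left s) (fun _ => Rabs (rel f a t0 z0 v0) + ln (T - t0))
      (fun x => Rabs (w x) + ln (T - x))).
    + apply filterlim_const.
    + apply (rlim_plus (at_left s) (fun x => Rabs (w x)) (fun x => ln (T - x))).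
      * now apply rlim_abs; [typeclasses eauto|].
      * apply (continuous_at_left (fun x => ln (T - x))), (ex_derive_continuous (fun x => ln (T - x))).
        eexists; apply is_derive_log_gap; lra.
    + apply at_left_iff; exists (s - t0); split; [lra|]; intros x Hx; apply IH; lra.
Qed.

Lemma speed_unbounded (f a : bool -> R -> R) (e T M C g t0 z0 v0 : R) (z v : R -> R) :
  closing_plates f a e T M C -> T - e < t0 < T ->
  ball_motion (f false) (f true) g T t0 z0 v0 z v ->
  threshold g M C < Rabs (rel f a t0 z0 v0) ->
  filterlim (fun t => Rabs (v t)) (at_left T) (Rbar_locally p_infty).
Proof.
  intros CP Ht0 B Hthr.
  assert (G := rel_growth f a e T M C g T t0 z0 v0 z v CP ltac:(lra) ltac:(lra) B Hthr).
  assert (HM := M_ge0 _ _ _ _ _ _ CP).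
  intros P [X HX].
  change (at_left T (fun t => P (Rabs (v t)))).
  apply at_left_iff.
  set (d := Rmin (T - t0) (exp (ln (T - t0) - X - M))).
  assert (d <= T - t0) by apply Rmin_l.
  assert (d <= exp (ln (T - t0) - X - M)) by apply Rmin_r.
  exists d; split; [apply Rmin_glb_lt; [lra|apply exp_pos]|].
  intros t Ht; apply HX.
  assert (L : ln (T - t) < ln (T - t0) - X - M).
  { rewrite <- (ln_exp (ln (T - t0) - X - M)); apply ln_increasing; lra. }
  specialize (G t ltac:(lra)).
  assert (RC := rel_close f a e T M C t (z t) (v t) CP ltac:(lra)
    (motion_between _ _ _ _ _ _ _ _ _ B t ltac:(lra))).
  assert (Tr := Rabs_triang (rel f a t (z t) (v t) - v t) (v t)).
  replace (rel f a t (z t) (v t) - v t + v t) with (rel f a t (z t) (v t)) in Tr by ring.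
  assert (0 < threshold g M C).
  { assert (Q := threshold_gt g M C HM (C_gt0 _ _ _ _ _ _ CP)).
    assert (Q' := Rabs_pos g); lra. }
  lra.
Qed.

(** * Existence of the motion *)

(** The start of a flight: the initial state, or the state just after a
    collision. *)
Record event := Event { time : R; height : R; speed : R; upward : bool }.

Definition path (g : R) (E : event) (x : R) : R :=
  height E + speed E * (x - time E) - g / 2 * (x - time E) ^ 2.

Definition velocity (g : R) (E : event) (x : R) : R :=
  speed E - g * (x - time E).

(** One inequality is strict and the other is not, because a flight may start on
    the plate that it leaves. *)
Record fast_event (f a : bool -> R -> R) (e T M C g : R) (E : event) : Prop := {
  fast_time : T - e < time E < T;
  fast_ahead : sg (upward E) * (height E - f (upward E) (time E)) < 0;
  fast_behind : 0 <= sg (upward E) * (height E - f (negb (upward E)) (time E));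
  fast_rel : threshold g M C < sg (upward E) * rel f a (time E) (height E) (speed E)
}.

Record next_event (f : bool -> R -> R) (g T : R) (E E' : event) : Prop := {
  next_time : time E < time E' < T;
  next_path : height E' = path g E (time E');
  next_plate : height E' = f (upward E) (time E');
  next_speed : speed E' = - velocity g E (time E') + 2 * Derive (f (upward E)) (time E');
  next_dir : upward E' = negb (upward E);
  next_inside : forall x, time E < x < time E' -> f false x < path g E x < f true x
}.

Lemma path_start (g : R) (E : event) : path g E (time E) = height E.
Proof. unfold path; ring. Qed.

Lemma velocity_start (g : R) (E : event) : velocity g E (time E) = speed E.
Proof. unfold velocity; ring. Qed.

Lemma path_derive (g : R) (E : event) (x : R) : is_derive (path g E) x (velocity g E x).
Proof. unfold path, velocity; auto_derive; [easy|field]. Qed.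

Lemma velocity_derive (g : R) (E : event) (x : R) : is_derive (velocity g E) x (- g).
Proof. unfold velocity; auto_derive; [easy|ring]. Qed.

Lemma path_continuous (g : R) (E : event) (x : R) : continuous (path g E) x.
Proof. apply (ex_derive_continuous (path g E)); eexists; apply path_derive. Qed.

Lemma velocity_continuous (g : R) (E : event) (x : R) : continuous (velocity g E) x.
Proof. apply (ex_derive_continuous (velocity g E)); eexists; apply velocity_derive. Qed.

Lemma between_plates (f : bool -> R -> R) (b : bool) (t z : R) :
  sg b * (z - f b t) < 0 -> 0 < sg b * (z - f (negb b) t) -> f false t < z < f true t.
Proof. destruct b; simpl; lra. Qed.

Lemma flight_motion (f : bool -> R -> R) (g s : R) (E : event) :
  f false (time E) <= height E <= f true (time E) ->
  (forall x, time E < x < s -> f false x < path g E x < f true x) ->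
  ball_motion (f false) (f true) g s (time E) (height E) (speed E) (path g E) (velocity g E).
Proof.
  intros H0 Hin; constructor.
  - split; [apply path_start|apply velocity_start].
  - intros t Ht; destruct (Req_dec t (time E)) as [->|]; [now rewrite path_start|].
    specialize (Hin t ltac:(lra)); lra.
  - intros; apply continuous_at_right, path_continuous.
  - intros; apply continuous_at_left, path_continuous.
  - intros; apply continuous_at_right, velocity_continuous.
  - intros t _ _; split; [apply path_derive|apply velocity_derive].
  - intros x Hx Ex; specialize (Hin x Hx); lra.
  - intros x Hx Ex; specialize (Hin x Hx); lra.
  - intros T' HT'; exists (time E :: nil); intros x Hx Hc; left.
    destruct (Req_dec (time E) x); [easy|].
    specialize (Hin x ltac:(lra)); lra.
Qed.

(** Both plates, behind as well as ahead, are slower than the ball by at least 1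
    during the whole flight; hence the subtracted term [y - time E]. *)
Lemma fast_flight_relative (f a : bool -> R -> R) (e T M C g : R) (E : event) (c : bool) (x : R) :
  closing_plates f a e T M C -> fast_event f a e T M C g E -> time E < x < T ->
  is_derive (fun y => sg (upward E) * (path g E y - f c y) - (y - time E)) x
    (sg (upward E) * (velocity g E x - Derive (f c) x) - 1) /\
  0 <= sg (upward E) * (velocity g E x - Derive (f c) x) - 1.
Proof.
  intros CP [[Ht1 Ht2] Ha Hb Hr] Hx.
  assert (HM := M_ge0 _ _ _ _ _ _ CP).
  assert (HW := window _ _ _ _ _ _ CP).
  assert (Thr := threshold_gt g M C HM (C_gt0 _ _ _ _ _ _ CP)).
  assert (G := gap_gt0 _ _ _ _ _ _ CP (time E) ltac:(lra)).
  assert (RC := rel_close f a e T M C (time E) (height E) (speed E) CP ltac:(lra)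
    ltac:(destruct (upward E); simpl in *; lra)).
  destruct (plate_diff _ _ _ _ _ _ CP c x ltac:(lra)) as [Xf Bf].
  apply Rabs_le_between in RC, Bf.
  split.
  - assert (Xp : ex_derive (path g E) x) by (eexists; apply path_derive).
    auto_derive; [now repeat split|].
    rewrite (is_derive_unique _ _ _ (path_derive g E x)
      : Derive (fun y => path g E y) x = velocity g E x).
    change (Derive (fun y => f c y) x) with (Derive (f c) x); ring.
  - assert (Gg : - Rabs g <= g * (x - time E) <= Rabs g).
    { assert (A1 := Rle_abs g); assert (A2 := Rle_abs (- g)); rewrite Rabs_Ropp in A2.
      assert (A3 := Rabs_pos g); split; nra. }
    unfold velocity; destruct (upward E); simpl in *; lra.
Qed.

(** The distance from the plate left behind is positive on the whole time interval
    up to [T], where the two plates coincide; so the flight has crossed the plate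
    ahead before [T].  The speed condition is inherited by the next event from
    [rel_growth] on the flight and [collision_gain] at its end. *)
Lemma next_event_exists (f a : bool -> R -> R) (e T M C g : R) (E : event) :
  closing_plates f a e T M C -> fast_event f a e T M C g E ->
  exists E', next_event f g T E E' /\ fast_event f a e T M C g E'.
Proof.
  intros CP F; assert (F' := F); destruct F' as [Ht Ha Hb Hr].
  assert (HM := M_ge0 _ _ _ _ _ _ CP).
  assert (Thr := threshold_gt g M C HM (C_gt0 _ _ _ _ _ _ CP)).
  assert (Hg := Rabs_pos g).
  set (b := upward E) in *.
  set (p := fun c y => sg b * (path g E y - f c y)).
  assert (Cp : forall c y, continuous (p c) y).
  { intros c y; apply (continuous_scal_r (sg b) (fun y => path g E y - f c y)).
    apply (continuous_minus (path g E) (f c));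
      [apply path_continuous|apply (plate_cont _ _ _ _ _ _ CP)]. }
  assert (Cq : forall c y, continuous (fun y => p c y - (y - time E)) y).
  { intros c y; apply (continuous_minus (p c) (fun y => y - time E)); [apply Cp|].
    apply (continuous_minus (fun y : R => y)); [apply continuous_id|apply continuous_const]. }
  assert (Dp : forall c x, time E < x < T ->
    exists d, is_derive (fun y => p c y - (y - time E)) x d /\ 0 <= d).
  { intros c x Hx; eexists; exact (fast_flight_relative f a e T M C g E c x CP F Hx). }
  assert (Behind : forall x, time E < x < T -> x - time E <= p (negb b) x).
  { intros x Hx.
    assert (Q := right_limit_le (fun y => p (negb b) y - (y - time E)) (time E) T _ (Dp (negb b))
      (continuous_at_right _ _ (Cq (negb b) (time E))) x Hx).
    unfold p in Q at 1; cbv beta in Q; rewrite path_start in Q; lra. }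
  assert (End : 0 < p b T).
  { assert (Eb : f b T = f (negb b) T)
      by (destruct b; simpl; rewrite (plates_meet _ _ _ _ _ _ CP); easy).
    unfold p; rewrite Eb; fold (p (negb b) T).
    assert (Q := le_left_limit (fun y => p (negb b) y - (y - time E)) (time E) T _ (Dp (negb b))
      (continuous_at_left _ _ (Cq (negb b) T)) ((time E + T) / 2) ltac:(lra)).
    assert (Q' := Behind ((time E + T) / 2) ltac:(lra)). cbv beta in Q; lra. }
  destruct (IVT (p b) (time E) T) as [t [Htt Ept]].
  { intros y; apply continuity_pt_filterlim, Cp. }
  { lra. }
  { unfold p; rewrite path_start; exact Ha. }
  { exact End. }
  assert (Ht' : time E < t < T).
  { split.
    - destruct (Req_dec t (time E)) as [->|]; [|lra].
      unfold p in Ept; rewrite path_start in Ept; lra.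
    - destruct (Req_dec t T) as [->|]; lra. }
  assert (Plate : path g E t = f b t).
  { unfold p in Ept; destruct b; simpl in Ept; lra. }
  assert (Inside : forall x, time E < x < t -> f false x < path g E x < f true x).
  { intros x Hx; apply (between_plates f b).
    - assert (Q := nondecreasing_of_derive (fun y => p b y - (y - time E)) (time E) T (Dp b) x t
        ltac:(lra) ltac:(lra) ltac:(lra)); cbv beta in Q.
      fold (p b x); lra.
    - specialize (Behind x ltac:(lra)); fold (p (negb b) x); lra. }
  set (v' := - velocity g E t + 2 * Derive (f b) t).
  exists (Event t (f b t) v' (negb b)); split; [now constructor|].
  assert (Gt := gap_gt0 _ _ _ _ _ _ CP t ltac:(lra)).
  assert (GE := gap_gt0 _ _ _ _ _ _ CP (time E) Ht).
  constructor; simpl; [lra|destruct b; simpl; lra|destruct b; simpl; lra|].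
  assert (AbsE : threshold g M C < Rabs (rel f a (time E) (height E) (speed E)))
    by (apply Rlt_le_trans with (1 := Hr), sg_le_abs).
  assert (Grow := rel_growth f a e T M C g t _ _ _ _ _ CP (proj1 Ht) ltac:(lra)
    (flight_motion f g t E ltac:(destruct b; simpl in *; lra) Inside) AbsE).
  assert (Grow' : forall x, time E <= x < t ->
    Rabs (rel f a (time E) (height E) (speed E)) <= Rabs (rel f a x (path g E x) (velocity g E x))).
  { intros x Hx; specialize (Grow x Hx).
    assert (ln (T - x) <= ln (T - time E)) by (apply ln_le; lra); lra. }
  (* The velocity with the collision included, right-continuous at t. *)
  set (v := fun x => if Rlt_dec x t then velocity g E x else v').
  assert (Vlt : forall x, x < t -> v x = velocity g E x)
    by (intros x Hx; unfold v; destruct (Rlt_dec x t); [easy|lra]).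
  assert (Vt : v t = v') by (unfold v; destruct (Rlt_dec t t); [lra|easy]).
  assert (Vlim : filterlim v (at_left t) (locally (velocity g E t))).
  { apply filterlim_ext_loc with (velocity g E).
    - apply at_left_iff; exists 1; split; [lra|]; intros x Hx; symmetry; apply Vlt; lra.
    - apply continuous_at_left, velocity_continuous. }
  destruct (collision_gain f a e T M C g t (time E) (path g E) v b CP (proj1 Ht) Ht')
    as [w [Lw Hw]].
  { intros x Hx; split; [now apply Inside|split].
    - rewrite Vlt by lra; apply path_derive.
    - rewrite Vlt by lra; specialize (Grow' x ltac:(lra)); lra. }
  { apply continuous_at_left, path_continuous. }
  { exact Plate. }
  { exists (velocity g E t); split; [exact Vlim|exact Vt]. }
  assert (Low : Rabs (rel f a (time E) (height E) (speed E)) <= Rabs w).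
  { apply (rlim_le (at_left t) (fun _ => Rabs (rel f a (time E) (height E) (speed E)))
      (fun x => Rabs (rel f a x (path g E x) (v x)))).
    - apply filterlim_const.
    - now apply rlim_abs; [typeclasses eauto|].
    - apply at_left_iff; exists (t - time E); split; [lra|]; intros x Hx.
      rewrite Vlt by lra; apply Grow'; lra. }
  rewrite Vt, Plate in Hw.
  rewrite (rel_on_plate f a e T M C t v' b CP) in Hw |- * by lra.
  assert (Big : threshold g M C < Rabs (v' - a b t)) by lra.
  destruct (plate_diff _ _ _ _ _ _ CP b t ltac:(lra)) as [_ Bf].
  destruct (barrier_diff _ _ _ _ _ _ CP b t ltac:(lra)) as [_ [Ba _]].
  destruct (fast_flight_relative f a e T M C g E b t CP F Ht') as [_ Away]; fold b in Away.
  (* The size of the new relative velocity is known; its sign is that of the new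
     velocity relative to the plate, since barrier and plate velocities are small
     compared with the threshold. *)
  apply Rabs_le_between in Bf, Ba.
  revert Big; unfold Rabs at 1; unfold v' in *.
  destruct Rcase_abs; destruct b; simpl in *; lra.
Qed.

(** With speeds [V n] that grow at most linearly in [n], the flight times are at
    least eta / V n and have a divergent sum.  Instead of the harmonic series one
    uses that the gain [D] is at most (D / eta) V n times the flight time, so
    that [V] grows at most exponentially in the time [s]; if the times were
    bounded, so would be the speeds, and the flight times would be bounded
    below. *)
Lemma bounded_gain_unbounded_times (s V : nat -> R) (eta D : R) :
  0 < eta -> 0 <= D ->
  (forall n, s n < s (S n)) ->
  (forall n, eta <= V n * (s (S n) - s n)) ->
  (forall n, V (S n) <= V n + D) ->
  forall t, exists n, t < s n.
Proof.
  intros He HD Hs HV Hg t.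
  apply NNPP; intros N.
  assert (Hst : forall n, s n <= t).
  { intros n; apply Rnot_lt_le; intros L; apply N; now exists n. }
  assert (Vpos : forall n, 0 < V n).
  { intros n; specialize (HV n); specialize (Hs n); nra. }
  set (k := D / eta).
  assert (Hk : 0 <= k) by (apply Rmult_le_pos; [easy|left; now apply Rinv_0_lt_compat]).
  assert (Exp : forall n, V n <= V 0%nat * exp (k * (s n - s 0%nat))).
  { induction n as [|n IH].
    - rewrite Rminus_diag, Rmult_0_r, exp_0; lra.
    - assert (Step : V (S n) <= V n * exp (k * (s (S n) - s n))).
      { assert (X := exp_ineq1_le (k * (s (S n) - s n))).
        assert (D <= V n * (k * (s (S n) - s n))).
        { replace D with (k * eta) by (unfold k; field; lra).
          specialize (HV n); nra. }
        specialize (Hg n); specialize (Vpos n); nra. }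
      replace (k * (s (S n) - s 0%nat))
        with (k * (s n - s 0%nat) + k * (s (S n) - s n)) by ring.
      rewrite exp_plus.
      assert (P := exp_pos (k * (s (S n) - s n))); nra. }
  set (W := V 0%nat * exp (k * (t - s 0%nat))).
  assert (HW : 0 < W) by (apply Rmult_lt_0_compat; [easy|apply exp_pos]).
  assert (HVW : forall n, V n <= W).
  { intros n; apply Rle_trans with (1 := Exp n).
    apply Rmult_le_compat_l; [specialize (Vpos 0%nat); lra|].
    specialize (Hst n).
    destruct (Rle_lt_or_eq_dec (k * (s n - s 0%nat)) (k * (t - s 0%nat))) as [L|L]; [nra| |].
    - left; now apply exp_increasing.
    - rewrite L; lra. }
  assert (Lin : forall n, s 0%nat + INR n * (eta / W) <= s n).
  { induction n as [|n IH]; [simpl; lra|].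
    rewrite S_INR.
    assert (eta / W <= s (S n) - s n); [|lra].
    apply Rmult_le_reg_r with W; [easy|].
    replace (eta / W * W) with eta by (field; lra).
    specialize (HV n); specialize (HVW n); specialize (Hs n); nra. }
  assert (Hq : 0 < eta / W) by (apply Rmult_lt_0_compat; [easy|now apply Rinv_0_lt_compat]).
  destruct (INR_unbounded ((t - s 0%nat) / (eta / W))) as [n Hn].
  apply (Rmult_lt_compat_r (eta / W)) in Hn; [|easy].
  unfold Rdiv at 1 in Hn; rewrite Rmult_assoc, Rinv_l in Hn by lra.
  specialize (Lin n); specialize (Hst n); lra.
Qed.

Lemma plate_displacement (f a : bool -> R -> R) (e T M C : R) (b : bool) (s t : R) :
  closing_plates f a e T M C -> T - e < s -> s <= t -> t < T ->
  Rabs (f b t - f b s) <= M * (t - s).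
Proof.
  intros CP Hs Hst Ht.
  destruct (MVT_gen (f b) s t (Derive (f b))) as [c [Hc Eq]].
  - intros x; rewrite Rmin_left, Rmax_right by lra; intros Hx.
    apply Derive_correct, (plate_diff _ _ _ _ _ _ CP b x); lra.
  - intros x _; apply continuity_pt_filterlim, (plate_cont _ _ _ _ _ _ CP).
  - rewrite Rmin_left, Rmax_right in Hc by lra.
    destruct (plate_diff _ _ _ _ _ _ CP b c ltac:(lra)) as [_ Bc].
    rewrite Eq, Rabs_mult, (Rabs_pos_eq (t - s)) by lra; nra.
Qed.

(** Each flight crosses the gap, whose minimum up to time [t] is positive.  The
    hypothesis on the heights, that every flight starts on the plate opposite to
    its target, can fail only for the initial flight of a motion. *)
Lemma bounce_times_unbounded (f a : bool -> R -> R) (e T M C g : R) (E : nat -> event) :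
  closing_plates f a e T M C ->
  (forall n, fast_event f a e T M C g (E n)) ->
  (forall n, next_event f g T (E n) (E (S n))) ->
  (forall n, height (E n) = f (negb (upward (E n))) (time (E n))) ->
  forall t, t < T -> exists n, t < time (E n).
Proof.
  intros CP F N P t Ht; apply NNPP; intros No.
  assert (Hle : forall n, time (E n) <= t).
  { intros n; apply Rnot_lt_le; intros L; apply No; now exists n. }
  assert (HM := M_ge0 _ _ _ _ _ _ CP).
  assert (HW := window _ _ _ _ _ _ CP).
  assert (Hg := Rabs_pos g).
  assert (Ht0 := fast_time _ _ _ _ _ _ _ _ (F 0%nat)).
  destruct (continuity_ab_min (fun x => f true x - f false x) (time (E 0%nat)) t) as [m [Hm Hmt]].
  { apply Hle. }
  { intros c _; apply continuity_pt_filterlim.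
    apply (continuous_minus (f true) (f false)); apply (plate_cont _ _ _ _ _ _ CP). }
  assert (Gm := gap_gt0 _ _ _ _ _ _ CP m ltac:(lra)).
  assert (Inc : forall n, time (E 0%nat) <= time (E n)).
  { induction n as [|n IH]; [lra|].
    destruct (next_time _ _ _ _ _ (N n)); lra. }
  destruct (bounded_gain_unbounded_times (fun n => time (E n))
    (fun n => Rabs (speed (E n)) + Rabs g + M) (f true m - f false m) (Rabs g + 2 * M))
    with (t := t) as [n Hn]; [lra|lra| | | |specialize (Hle n); lra].
  - intros n; apply (next_time _ _ _ _ _ (N n)).
  - intros n.
    assert (Tn := fast_time _ _ _ _ _ _ _ _ (F n)).
    destruct (next_time _ _ _ _ _ (N n)) as [L1 L2].
    assert (Pl := next_plate _ _ _ _ _ (N n)).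
    assert (Pa := next_path _ _ _ _ _ (N n)).
    unfold path in Pa; rewrite Pl, (P n) in Pa.
    assert (Dis := plate_displacement f a e T M C (upward (E n)) (time (E n)) (time (E (S n)))
      CP ltac:(lra) ltac:(lra) L2).
    specialize (Hm (time (E n)) (conj (Inc n) (Hle n))).
    set (dt := time (E (S n)) - time (E n)) in *.
    assert (Hdt : 0 < dt <= 1) by (unfold dt; lra).
    assert (Acc : Rabs (speed (E n) * dt - g / 2 * dt ^ 2) <= (Rabs (speed (E n)) + Rabs g) * dt).
    { replace (speed (E n) * dt - g / 2 * dt ^ 2) with ((speed (E n) + - (g * (dt / 2))) * dt) by field.
      rewrite Rabs_mult, (Rabs_pos_eq dt) by lra.
      apply Rmult_le_compat_r; [lra|].
      apply Rle_trans with (1 := Rabs_triang _ _).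
      rewrite Rabs_Ropp, Rabs_mult, (Rabs_pos_eq (dt / 2)) by lra; nra. }
    apply Rabs_le_between in Acc, Dis.
    destruct (upward (E n)); simpl in *; nra.
  - intros n.
    assert (Tn := fast_time _ _ _ _ _ _ _ _ (F n)).
    destruct (next_time _ _ _ _ _ (N n)) as [L1 L2].
    rewrite (next_speed _ _ _ _ _ (N n)).
    destruct (plate_diff _ _ _ _ _ _ CP (upward (E n)) (time (E (S n))) ltac:(lra))
      as [_ B].
    unfold velocity; set (dt := time (E (S n)) - time (E n)).
    set (d := Derive _ _) in *.
    assert (Rabs (g * dt) <= Rabs g).
    { rewrite Rabs_mult, (Rabs_pos_eq dt) by (unfold dt; lra).
      assert (dt <= 1) by (unfold dt; lra). nra. }
    replace (- (speed (E n) - g * dt) + 2 * d) with (- speed (E n) + (g * dt + 2 * d)) by ring.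
    assert (T1 := Rabs_triang (- speed (E n)) (g * dt + 2 * d)).
    assert (T2 := Rabs_triang (g * dt) (2 * d)).
    rewrite Rabs_Ropp in T1.
    rewrite (Rabs_mult 2), (Rabs_pos_eq 2) in T2 by lra. lra.
Qed.

(** Two ways to locate a time among the events are needed: [s n <= x < s (S n)]
    gives the value and the right limit at [x], and [s n < x <= s (S n)] the left
    limit, which at a collision belongs to the flight that ends there. *)
Lemma glued_motion (f : bool -> R -> R) (g T : R) (E : nat -> event) :
  (forall n, f false (time (E n)) < f true (time (E n))) ->
  f false (time (E 0%nat)) <= height (E 0%nat) <= f true (time (E 0%nat)) ->
  (forall n, next_event f g T (E n) (E (S n))) ->
  (forall t, t < T -> exists n, t < time (E n)) ->
  exists z v, ball_motion (f false) (f true) g T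
    (time (E 0%nat)) (height (E 0%nat)) (speed (E 0%nat)) z v.
Proof.
  intros Gap H0 N Unb.
  set (s := fun n => time (E n)).
  assert (Inc : forall n, s n < s (S n)) by (intros n; apply (next_time _ _ _ _ _ (N n))).
  assert (Mono : forall n m, (n <= m)%nat -> s n <= s m).
  { intros n m H; induction H as [|m H IH]; [lra|]; specialize (Inc m); lra. }
  assert (Last : forall x, s 0%nat <= x < T -> exists n, s n <= x < s (S n)).
  { intros x [Hx0 HxT]; destruct (Unb x HxT) as [n Hn]; fold (s n) in Hn.
    induction n as [|n IH]; [lra|].
    destruct (Rlt_le_dec x (s n)); [now apply IH|now exists n]. }
  assert (LastL : forall x, s 0%nat < x < T -> exists n, s n < x <= s (S n)).
  { intros x Hx; destruct (Last x ltac:(lra)) as [n Hn].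
    destruct (Req_dec x (s n)) as [Ex|]; [|exists n; lra].
    destruct n as [|n]; [lra|]. exists n; specialize (Inc n); lra. }
  assert (Choice : forall x, {n | s 0%nat <= x < T -> s n <= x < s (S n)}).
  { intros x; apply constructive_indefinite_description.
    destruct (classic (s 0%nat <= x < T)) as [Hx|Hx].
    - destruct (Last x Hx) as [n Hn]; now exists n.
    - exists 0%nat; intros Hx'; contradiction. }
  set (idx := fun x => proj1_sig (Choice x)).
  assert (HsT : forall n, s n < T) 
    by (intros n; specialize (Inc n); destruct (next_time _ _ _ _ _ (N n)) as [_ L];
        fold (s (S n)) in L; lra).
  assert (Idx : forall n x, s n <= x < s (S n) -> idx x = n).
  { intros n x Hx.
    assert (Hi := proj2_sig (Choice x)); cbv beta in Hi; fold (idx x) in Hi.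
    assert (L0 := Mono 0%nat n ltac:(lia)). assert (L1 := HsT (S n)).
    specialize (Hi ltac:(lra)).
    destruct (lt_eq_lt_dec (idx x) n) as [[L|Eq]|L]; [|easy|].
    - assert (Q := Mono (S (idx x)) n ltac:(lia)); lra.
    - assert (Q := Mono (S n) (idx x) ltac:(lia)); lra. }
  set (z := fun x => path g (E (idx x)) x).
  set (v := fun x => velocity g (E (idx x)) x).
  assert (Zn : forall n x, s n <= x < s (S n) ->
    z x = path g (E n) x /\ v x = velocity g (E n) x).
  { intros n x Hx; unfold z, v; now rewrite (Idx n x Hx). }
  assert (Zs : forall n, z (s n) = height (E n) /\ v (s n) = speed (E n)).
  { intros n; destruct (Zn n (s n)) as [-> ->]; [specialize (Inc n); lra|].
    split; [apply path_start|apply velocity_start]. }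
  assert (Inside : forall n x, s n < x < s (S n) -> f false x < z x < f true x).
  { intros n x Hx; destruct (Zn n x) as [-> _]; [lra|].
    now apply (next_inside _ _ _ _ _ (N n)). }
  assert (OnPlate : forall n, z (s (S n)) = f (upward (E n)) (s (S n))).
  { intros n; rewrite (proj1 (Zs (S n))); apply (next_plate _ _ _ _ _ (N n)). }
  assert (Left : forall n x, s n < x <= s (S n) ->
    at_left x (fun y => path g (E n) y = z y /\ velocity g (E n) y = v y)).
  { intros n x Hx; apply at_left_iff; exists (x - s n); split; [lra|]; intros y Hy.
    destruct (Zn n y) as [-> ->]; [lra|easy]. }
  assert (Right : forall n x, s n <= x < s (S n) ->
    at_right x (fun y => path g (E n) y = z y /\ velocity g (E n) y = v y)).
  { intros n x Hx; apply at_right_iff; exists (s (S n) - x); split; [lra|]; intros y Hy.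
    destruct (Zn n y) as [-> ->]; [lra|easy]. }
  assert (Collision : forall c x, s 0%nat < x < T -> z x = f c x -> elastic_collision (f c) v x).
  { intros c x Hx Ec; destruct (LastL x Hx) as [n Hn].
    destruct (Req_dec x (s (S n))) as [->|Nx].
    2:{ specialize (Inside n x ltac:(lra)); destruct c; lra. }
    assert (Eq : c = upward (E n)).
    { specialize (Gap (S n)); fold (s (S n)) in Gap; rewrite OnPlate in Ec.
      destruct c, (upward (E n)); try easy; lra. }
    subst c; exists (velocity g (E n) (s (S n))); split.
    - apply filterlim_ext_loc with (velocity g (E n)).
      + generalize (Left n _ Hn); apply filter_imp; tauto.
      + apply continuous_at_left, velocity_continuous.
    - rewrite (proj2 (Zs (S n))); apply (next_speed _ _ _ _ _ (N n)). }
  exists z, v; constructor.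
  - apply Zs.
  - intros x Hx; destruct (Last x Hx) as [n Hn].
    destruct (Req_dec x (s n)) as [->|Nx]; [|specialize (Inside n x ltac:(lra)); lra].
    destruct n as [|n]; [rewrite (proj1 (Zs 0%nat)); exact H0|].
    rewrite OnPlate; specialize (Gap (S n)); fold (s (S n)) in Gap.
    destruct (upward (E n)); lra.
  - intros x Hx; destruct (Last x Hx) as [n Hn]; rewrite (proj1 (Zn n x Hn)).
    apply filterlim_ext_loc with (path g (E n)); [|apply continuous_at_right, path_continuous].
    generalize (Right n x Hn); apply filter_imp; tauto.
  - intros x Hx; destruct (LastL x Hx) as [n Hn].
    assert (Ez : z x = path g (E n) x).
    { destruct (Req_dec x (s (S n))) as [->|Nx]; [|now apply Zn; lra].
      rewrite (proj1 (Zs (S n))); apply (next_path _ _ _ _ _ (N n)). }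
    rewrite Ez.
    apply filterlim_ext_loc with (path g (E n)); [|apply continuous_at_left, path_continuous].
    generalize (Left n x Hn); apply filter_imp; tauto.
  - intros x Hx; destruct (Last x Hx) as [n Hn]; rewrite (proj2 (Zn n x Hn)).
    apply filterlim_ext_loc with (velocity g (E n));
      [|apply continuous_at_right, velocity_continuous].
    generalize (Right n x Hn); apply filter_imp; tauto.
  - intros x Hx Fx; destruct (LastL x Hx) as [n Hn].
    destruct (Req_dec x (s (S n))) as [->|Nx].
    { rewrite OnPlate in Fx; destruct (upward (E n)); lra. }
    assert (Loc : locally x (fun y => path g (E n) y = z y /\ velocity g (E n) y = v y)).
    { apply (locally_interval _ x (s n) (s (S n))); simpl; [lra|lra|].
      intros y H1 H2; destruct (Zn n y) as [-> ->]; [simpl in *; lra|easy]. }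
    rewrite (proj2 (Zn n x ltac:(lra))); split.
    + apply is_derive_ext_loc with (path g (E n)); [|apply path_derive].
      revert Loc; apply filter_imp; tauto.
    + apply is_derive_ext_loc with (velocity g (E n)); [|apply velocity_derive].
      revert Loc; apply filter_imp; tauto.
  - apply (Collision false).
  - apply (Collision true).
  - intros T' HT'; destruct (Unb T' HT') as [m Hm]; fold (s m) in Hm.
    exists (map s (seq 0 m)); intros x Hx Hc.
    destruct (Last x ltac:(unfold s; lra)) as [n Hn].
    destruct (Req_dec x (s n)) as [->|Nx].
    + apply in_map, in_seq; split; [lia|].
      destruct (Nat.lt_ge_cases n m) as [|L]; [lia|].
      specialize (Mono m n L); lra.
    + specialize (Inside n x ltac:(lra)); lra.
Qed.

Lemma fast_motion_exists (f a : bool -> R -> R) (e T M C g : R) (E : event) :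
  closing_plates f a e T M C -> fast_event f a e T M C g E ->
  exists z v, ball_motion (f false) (f true) g T (time E) (height E) (speed E) z v.
Proof.
  intros CP F0.
  assert (Step : forall E, {E' | fast_event f a e T M C g E ->
    next_event f g T E E' /\ fast_event f a e T M C g E'}).
  { intros E1; apply constructive_indefinite_description.
    destruct (classic (fast_event f a e T M C g E1)) as [F|F].
    - destruct (next_event_exists f a e T M C g E1 CP F) as [E' H]; now exists E'.
    - exists E1; intros F'; contradiction. }
  set (En := fun n => Nat.iter n (fun E => proj1_sig (Step E)) E).
  assert (F : forall n, fast_event f a e T M C g (En n)).
  { induction n as [|n IH]; [exact F0|]; now apply (proj2_sig (Step (En n))). }
  assert (N : forall n, next_event f g T (En n) (En (S n)))
    by (intros n; now apply (proj2_sig (Step (En n)))).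
  apply (glued_motion f g T En).
  - intros n; apply (gap_gt0 _ _ _ _ _ _ CP), (fast_time _ _ _ _ _ _ _ _ (F n)).
  - destruct F0 as [_ Fa Fb _]; simpl; destruct (upward E); simpl in *; lra.
  - exact N.
  - intros t Ht.
    destruct (bounce_times_unbounded f a e T M C g (fun n => En (S n)) CP
      (fun n => F (S n)) (fun n => N (S n))) with (t := t) as [n Hn].
    + intros n; rewrite (next_dir _ _ _ _ _ (N n)), Bool.negb_involutive.
      apply (next_plate _ _ _ _ _ (N n)).
    + exact Ht.
    + now exists (S n).
Qed.

(** An initial position on a plate is compatible with [fast_event] because an
    admissible velocity does not point into that plate. *)
Theorem closing_plates_unbounded (f a : bool -> R -> R) (e T M C g t0 z0 v0 : R) :
  closing_plates f a e T M C -> T - e < t0 < T ->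
  admissible_initial (f false) (f true) t0 z0 v0 ->
  threshold g M C + M < Rabs v0 ->
  unbounded_velocity (f false) (f true) g T t0 z0 v0.
Proof.
  intros CP Ht [Hz [Hlo Hhi]] Hv.
  assert (HM := M_ge0 _ _ _ _ _ _ CP).
  assert (Thr := threshold_gt g M C HM (C_gt0 _ _ _ _ _ _ CP)).
  assert (Hg := Rabs_pos g).
  assert (RC := rel_close f a e T M C t0 z0 v0 CP Ht Hz).
  assert (G := gap_gt0 _ _ _ _ _ _ CP t0 Ht).
  destruct (plate_diff _ _ _ _ _ _ CP false t0 Ht) as [_ B0].
  destruct (plate_diff _ _ _ _ _ _ CP true t0 Ht) as [_ B1].
  apply Rabs_le_between in RC, B0, B1.
  destruct (sg_abs v0) as [b Eb]; rewrite <- Eb in Hv.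
  assert (Fast : threshold g M C < sg b * rel f a t0 z0 v0) by (destruct b; simpl in *; lra).
  split.
  - apply (fast_motion_exists f a e T M C g (Event t0 z0 v0 b) CP).
    constructor; simpl; [easy| | |easy].
    + destruct b; simpl in *.
      * destruct (Req_dec z0 (f true t0)) as [Ez|]; [specialize (Hhi Ez)|]; lra.
      * destruct (Req_dec z0 (f false t0)) as [Ez|]; [specialize (Hlo Ez)|]; lra.
    + destruct b; simpl in *; lra.
  - intros z v B; apply (speed_unbounded f a e T M C g t0 z0 v0 z v CP Ht B).
    apply Rlt_le_trans with (1 := Fast), sg_le_abs.
Qed.

(** * Plates with contact of order 0 or 1 *)

(** [K] may have either sign: a negative [K] turns a positive lower bound on the
    derivative into a strict upper bound on [f]. *)
Lemma le_left_limit_linear (f df : R -> R) (a b l K : R) :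
  (forall x, a < x < b -> is_derive f x (df x) /\ - K <= df x) ->
  filterlim f (at_left b) (locally l) ->
  forall x, a < x < b -> f x <= l + K * (b - x).
Proof.
  intros H Hl x Hx.
  assert (Q : f x - K * (b - x) <= l - K * (b - b)); [|lra].
  apply (le_left_limit (fun x => f x - K * (b - x)) a b).
  - intros y Hy; destruct (H y Hy) as [D HD]; exists (df y + K); split; [|lra].
    assert (ex_derive f y) by (now exists (df y)).
    auto_derive; [easy|].
    rewrite (is_derive_unique _ _ _ D : Derive (fun x => f x) y = df y); ring.
  - apply rlim_minus; [typeclasses eauto|easy|].
    apply (continuous_at_left (fun x => K * (b - x))).
    apply (ex_derive_continuous (fun x => K * (b - x))); now auto_derive.
  - easy.
Qed.

Lemma eventually_near (F : (R -> Prop) -> Prop) {FF : Filter F} (f : R -> R) (l d : R) :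
  filterlim f F (locally l) -> 0 < d -> F (fun x => l - d < f x < l + d).
Proof.
  intros H Hd; apply (H (fun y => l - d < y < l + d)); exists (mkposreal d Hd); intros y Hy.
  change (Rabs (y - l) < d) in Hy; apply Rabs_lt_between in Hy; lra.
Qed.

Lemma eventually_bounded (F : (R -> Prop) -> Prop) {FF : Filter F} (f : R -> R) (l : R) :
  filterlim f F (locally l) -> F (fun x => Rabs (f x) <= Rabs l + 1).
Proof.
  intros H; apply (filter_imp (fun x => l - 1 < f x < l + 1));
    [intros x Hx|exact (eventually_near F f l 1 H Rlt_0_1)].
  unfold Rabs; destruct (Rcase_abs (f x)), (Rcase_abs l); lra.
Qed.

Lemma left_extension_value (k : nat) (f : R -> R) (T : R) (L : nat -> R) :
  continuous f T -> left_extension k f T L -> L 0%nat = f T.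
Proof.
  intros Hc HL.
  apply (filterlim_locally_unique (F := at_left T) f).
  - exact (HL 0%nat (Nat.le_0_l k)).
  - now apply continuous_at_left.
Qed.

Definition plates (f1 f2 : R -> R) (b : bool) : R -> R := if b then f2 else f1.

(** The gap tends to 0 with a nonzero slope, negative because the gap is
    positive.  Constant barriers at a quarter of the slope difference from the
    two limits leave a1 - a2 equal to half of that difference. *)
Lemma closing_plates_order1 (f1 f2 : R -> R) (T eps l1 l2 : R) :
  (forall t, continuous f1 t) -> (forall t, continuous f2 t) -> 0 < eps ->
  (forall t, T - eps < t < T -> ex_derive f1 t /\ ex_derive f2 t /\ f1 t < f2 t) ->
  f1 T = f2 T ->
  filterlim (Derive f1) (at_left T) (locally l1) ->
  filterlim (Derive f2) (at_left T) (locally l2) ->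
  l1 <> l2 ->
  exists a e M C, closing_plates (plates f1 f2) a e T M C.
Proof.
  intros C1 C2 He Df Meet Lim1 Lim2 Hl.
  set (h := fun x => f2 x - f1 x).
  set (dh := fun x => Derive f2 x - Derive f1 x).
  assert (Dh : forall x, T - eps < x < T -> is_derive h x (dh x)).
  { intros x Hx; destruct (Df x Hx) as [D1 [D2 _]].
    apply (is_derive_minus f2 f1); now apply Derive_correct. }
  assert (Lh : filterlim h (at_left T) (locally 0)).
  { replace 0 with (h T) by (unfold h; lra).
    apply continuous_at_left, (continuous_minus f2 f1); easy. }
  assert (Lim : filterlim dh (at_left T) (locally (l2 - l1)))
    by (apply rlim_minus; [typeclasses eauto|easy|easy]).
  assert (Sign : l2 < l1).
  { apply Rnot_le_lt; intros N.
    assert (Ev := eventually_near (at_left T) dh _ (l2 - l1) Lim ltac:(lra)).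
    apply at_left_iff in Ev; destruct Ev as [d [Hd Ev]].
    set (r := Rmin d eps).
    assert (r <= d) by apply Rmin_l.
    assert (r <= eps) by apply Rmin_r.
    assert (0 < r) by (apply Rmin_glb_lt; lra).
    assert (Q := le_left_limit_linear h dh (T - r) T 0 0).
    specialize (Q ltac:(intros x Hx; split; [apply Dh; lra|specialize (Ev x ltac:(lra)); lra])
      Lh (T - r / 2) ltac:(lra)).
    destruct (Df (T - r / 2)) as [_ [_ P]]; [lra|]; unfold h in Q; lra. }
  set (D := l1 - l2).
  assert (HD : 0 < D) by (unfold D; lra).
  set (M := Rabs l1 + 1 + (Rabs l2 + 1)).
  assert (Hl1 := Rabs_pos l1); assert (Hl2 := Rabs_pos l2).
  set (a := fun (b : bool) (_ : R) => if b then l2 + D / 4 else l1 - D / 4).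
  assert (Ev : at_left T (fun t =>
    (Rabs (Derive f1 t) <= Rabs l1 + 1 /\ Rabs (Derive f2 t) <= Rabs l2 + 1) /\
    (l1 - D / 4 < Derive f1 t < l1 + D / 4 /\ l2 - D / 4 < Derive f2 t < l2 + D / 4))).
  { apply filter_and; apply filter_and;
      (apply eventually_bounded || apply eventually_near);
      first [typeclasses eauto|easy|lra]. }
  apply at_left_iff in Ev; destruct Ev as [d [Hd Ev]].
  set (e := Rmin (Rmin d eps) 1).
  assert (e <= Rmin d eps) by apply Rmin_l.
  assert (e <= 1) by apply Rmin_r.
  assert (Rmin d eps <= d) by apply Rmin_l.
  assert (Rmin d eps <= eps) by apply Rmin_r.
  assert (0 < e) by (repeat apply Rmin_glb_lt; lra).
  exists a, e, M, 4; constructor.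
  - lra.
  - unfold M; lra.
  - lra.
  - intros [|]; [apply C2|apply C1].
  - exact Meet.
  - intros t Ht; apply Df; lra.
  - intros b t Ht; destruct (Df t ltac:(lra)) as [D1 [D2 _]].
    destruct (Ev t ltac:(lra)) as [[B1 B2] _].
    destruct b; (split; [easy|]); unfold M; simpl; lra.
  - intros b t Ht; split; [apply ex_derive_const|split].
    + unfold a, M; assert (A1 := Rle_abs l1); assert (A2 := Rle_abs (- l1)).
      assert (A3 := Rle_abs l2); assert (A4 := Rle_abs (- l2)).
      rewrite Rabs_Ropp in A2, A4.
      apply Rabs_le_between; unfold D; destruct b; lra.
    + unfold a; rewrite Derive_const, Rabs_R0; unfold M; lra.
  - intros t Ht; destruct (Ev t ltac:(lra)) as [_ [B1 _]]; unfold a; simpl; lra.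
  - intros t Ht; destruct (Ev t ltac:(lra)) as [_ [_ B2]]; unfold a; simpl; lra.
  - intros t Ht.
    assert (Q := le_left_limit_linear h dh (T - e) T 0 (2 * D)).
    specialize (Q ltac:(intros x Hx; split; [apply Dh; lra|
      destruct (Ev x ltac:(lra)) as [_ B]; unfold dh, D in *; lra]) Lh t Ht).
    unfold h in Q; unfold a; simpl.
    replace (l1 - D / 4 - (l2 + D / 4)) with (D / 2) by (unfold D; lra); lra.
Qed.

(** The second derivative of the gap has a nonzero limit D, positive because the
    gap is.  Integrating twice from T, the closing speed is at least
    (D / 2) (T - t) and the gap is at most D (T - t)^2, whence the constant 2. *)
Lemma closing_plates_order2 (f1 f2 : R -> R) (T eps l m1 m2 : R) :
  (forall t, continuous f1 t) -> (forall t, continuous f2 t) -> 0 < eps ->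
  (forall t, T - eps < t < T -> ex_derive f1 t /\ ex_derive f2 t /\
     ex_derive (Derive f1) t /\ ex_derive (Derive f2) t /\ f1 t < f2 t) ->
  f1 T = f2 T ->
  filterlim (Derive f1) (at_left T) (locally l) ->
  filterlim (Derive f2) (at_left T) (locally l) ->
  filterlim (Derive (Derive f1)) (at_left T) (locally m1) ->
  filterlim (Derive (Derive f2)) (at_left T) (locally m2) ->
  m1 <> m2 ->
  exists a e M C, closing_plates (plates f1 f2) a e T M C.
Proof.
  intros C1 C2 He Df Meet Lim1 Lim2 LimD1 LimD2 Hm.
  set (h := fun x => f2 x - f1 x).
  set (dh := fun x => Derive f2 x - Derive f1 x).
  set (ddh := fun x => Derive (Derive f2) x - Derive (Derive f1) x).
  assert (Dh : forall x, T - eps < x < T -> is_derive h x (dh x)).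
  { intros x Hx; destruct (Df x Hx) as [D1 [D2 _]].
    apply (is_derive_minus f2 f1); now apply Derive_correct. }
  assert (Ddh : forall x, T - eps < x < T -> is_derive dh x (ddh x)).
  { intros x Hx; destruct (Df x Hx) as [_ [_ [D1 [D2 _]]]].
    apply (is_derive_minus (Derive f2) (Derive f1)); now apply Derive_correct. }
  assert (Lh : filterlim h (at_left T) (locally 0)).
  { replace 0 with (h T) by (unfold h; lra).
    apply continuous_at_left, (continuous_minus f2 f1); easy. }
  assert (Ldh : filterlim dh (at_left T) (locally 0)).
  { replace 0 with (l - l) by ring; apply rlim_minus; [typeclasses eauto|easy|easy]. }
  assert (Ldh' : filterlim (fun x => - dh x) (at_left T) (locally 0)).
  { replace 0 with (- 0) by ring.
    apply (filterlim_comp _ _ _ dh Ropp _ _ _ Ldh (filterlim_opp 0)). }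
  assert (Lim : filterlim ddh (at_left T) (locally (m2 - m1)))
    by (apply rlim_minus; [typeclasses eauto|easy|easy]).
  assert (Ndh : forall x, T - eps < x < T -> is_derive (fun x => - dh x) x (- ddh x))
    by (intros x Hx; apply (is_derive_opp dh); now apply Ddh).
  assert (Sign : m1 < m2).
  { apply Rnot_le_lt; intros N.
    assert (Ev := eventually_near (at_left T) ddh _ (m1 - m2) Lim ltac:(lra)).
    apply at_left_iff in Ev; destruct Ev as [d [Hd Ev]].
    set (r := Rmin d eps).
    assert (r <= d) by apply Rmin_l.
    assert (r <= eps) by apply Rmin_r.
    assert (0 < r) by (apply Rmin_glb_lt; lra).
    assert (Q' := le_left_limit_linear (fun x => - dh x) (fun x => - ddh x) (T - r) T 0 0).
    specialize (Q' ltac:(intros x Hx; split; [apply Ndh; lra|specialize (Ev x ltac:(lra)); lra])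
      Ldh').
    assert (Q := le_left_limit_linear h dh (T - r) T 0 0).
    specialize (Q ltac:(intros x Hx; split; [apply Dh; lra|specialize (Q' x Hx); lra])
      Lh (T - r / 2) ltac:(lra)).
    destruct (Df (T - r / 2)) as [_ [_ [_ [_ P]]]]; [lra|]; unfold h in Q; lra. }
  set (D := m2 - m1).
  assert (HD : 0 < D) by (unfold D; lra).
  set (M := Rabs l + 1 + (Rabs m1 + 1) + (Rabs m2 + 1)).
  assert (Hl := Rabs_pos l); assert (Hm1 := Rabs_pos m1); assert (Hm2 := Rabs_pos m2).
  assert (Ev : at_left T (fun t =>
    ((Rabs (Derive f1 t) <= Rabs l + 1 /\ Rabs (Derive f2 t) <= Rabs l + 1) /\
     (Rabs (Derive (Derive f1) t) <= Rabs m1 + 1 /\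
      Rabs (Derive (Derive f2) t) <= Rabs m2 + 1)) /\
    D - D / 2 < ddh t < D + D / 2)).
  { apply filter_and; [apply filter_and; apply filter_and; apply eventually_bounded
                        |apply eventually_near];
      first [typeclasses eauto|easy|lra]. }
  apply at_left_iff in Ev; destruct Ev as [d [Hd Ev]].
  set (e := Rmin (Rmin d eps) 1).
  assert (e <= Rmin d eps) by apply Rmin_l.
  assert (e <= 1) by apply Rmin_r.
  assert (Rmin d eps <= d) by apply Rmin_l.
  assert (Rmin d eps <= eps) by apply Rmin_r.
  assert (0 < e) by (repeat apply Rmin_glb_lt; lra).
  assert (Rate : forall x, T - e < x < T ->
    D / 2 * (T - x) <= - dh x <= 2 * D * (T - x)).
  { intros x Hx.
    assert (Q1 := le_left_limit_linear dh ddh (T - e) T 0 (- (D / 2))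
      ltac:(intros y Hy; split; [apply Ddh; lra|destruct (Ev y ltac:(lra)) as [_ B]; lra])
      Ldh x Hx).
    assert (Q2 := le_left_limit_linear (fun x => - dh x) (fun x => - ddh x) (T - e) T 0 (2 * D)
      ltac:(intros y Hy; split; [apply Ndh; lra|destruct (Ev y ltac:(lra)) as [_ B]; lra])
      Ldh' x Hx).
    cbv beta in Q2; lra. }
  exists (fun b => Derive (plates f1 f2 b)), e, M, 2; constructor.
  - lra.
  - unfold M; lra.
  - lra.
  - intros [|]; [apply C2|apply C1].
  - exact Meet.
  - intros t Ht; apply Df; lra.
  - intros b t Ht; destruct (Df t ltac:(lra)) as [D1 [D2 _]].
    destruct (Ev t ltac:(lra)) as [[[B1 B2] _] _].
    destruct b; (split; [easy|]); unfold M; simpl; lra.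
  - intros b t Ht; destruct (Df t ltac:(lra)) as [_ [_ [D1 [D2 _]]]].
    destruct (Ev t ltac:(lra)) as [[[B1 B2] [B3 B4]] _].
    destruct b; (split; [easy|]); unfold M; simpl; lra.
  - intros t Ht; simpl; lra.
  - intros t Ht; simpl; lra.
  - intros t Ht.
    assert (Q : h t - D * (T - t) ^ 2 <= 0 - D * (T - T) ^ 2).
    { apply (le_left_limit (fun x => h x - D * (T - x) ^ 2) (T - e) T).
      - intros x Hx; exists (dh x + 2 * D * (T - x)); split.
        + assert (ex_derive h x) by (exists (dh x); apply Dh; lra).
          auto_derive; [easy|].
          rewrite (is_derive_unique _ _ _ (Dh x ltac:(lra)) : Derive (fun x => h x) x = dh x); ring.
        + destruct (Rate x Hx); lra.
      - apply rlim_minus; [typeclasses eauto|easy|].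
        apply (continuous_at_left (fun x => D * (T - x) ^ 2)).
        apply (ex_derive_continuous (fun x => D * (T - x) ^ 2)); now auto_derive.
      - easy. }
    destruct (Rate t Ht) as [R1 _]; unfold h, dh in *; simpl in *; nra.
Qed.

Theorem theorem2 (g : R) (f1 f2 : R -> R) (tstar eps1 : R) (k : nat) (L1 L2 : nat -> R)
  (g_ge0 : 0 <= g)
  (f1_cont : forall t, continuous f1 t)
  (f2_cont : forall t, continuous f2 t)
  (eps1_gt0 : 0 < eps1)
  (k_12 : k = 1%nat \/ k = 2%nat)
  (f1_Ck : Ck_on k f1 (tstar - eps1) tstar)
  (f2_Ck : Ck_on k f2 (tstar - eps1) tstar)
  (f1_lt_f2 : forall t, tstar - eps1 < t < tstar -> f1 t < f2 t)
  (f1_ext : left_extension k f1 tstar L1)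
  (f2_ext : left_extension k f2 tstar L2)
  (L_eq : forall j, (j < k)%nat -> L1 j = L2 j)
  (L_neq : L1 k <> L2 k) :
  exists K eps, 0 < K /\ 0 < eps /\
    forall t0 z0 v0, tstar - eps < t0 < tstar ->
      admissible_initial f1 f2 t0 z0 v0 ->
      K < Rabs v0 ->
      unbounded_velocity f1 f2 g tstar t0 z0 v0.
Proof.
  assert (Meet : f1 tstar = f2 tstar).
  { rewrite <- (left_extension_value k f1 tstar L1 (f1_cont tstar) f1_ext).
    rewrite <- (left_extension_value k f2 tstar L2 (f2_cont tstar) f2_ext).
    apply L_eq; lia. }
  assert (CP : exists a e M C, closing_plates (plates f1 f2) a e tstar M C).
  { destruct k_12 as [-> | ->].
    - apply (closing_plates_order1 f1 f2 tstar eps1 (L1 1%nat) (L2 1%nat)); try easy.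
      + intros t Ht; split; [|split; [|now apply f1_lt_f2]].
        * exact (proj1 (f1_Ck t Ht 1%nat ltac:(lia))).
        * exact (proj1 (f2_Ck t Ht 1%nat ltac:(lia))).
      + exact (f1_ext 1%nat ltac:(lia)).
      + exact (f2_ext 1%nat ltac:(lia)).
    - apply (closing_plates_order2 f1 f2 tstar eps1 (L1 1%nat) (L1 2%nat) (L2 2%nat)); try easy.
      + intros t Ht; repeat split.
        * exact (proj1 (f1_Ck t Ht 1%nat ltac:(lia))).
        * exact (proj1 (f2_Ck t Ht 1%nat ltac:(lia))).
        * exact (proj1 (f1_Ck t Ht 2%nat ltac:(lia))).
        * exact (proj1 (f2_Ck t Ht 2%nat ltac:(lia))).
        * now apply f1_lt_f2.
      + exact (f1_ext 1%nat ltac:(lia)).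
      + rewrite (L_eq 1%nat ltac:(lia)); exact (f2_ext 1%nat ltac:(lia)).
      + exact (f1_ext 2%nat ltac:(lia)).
      + exact (f2_ext 2%nat ltac:(lia)). }
  destruct CP as [a [e [M [C CP]]]].
  assert (HM := M_ge0 _ _ _ _ _ _ CP).
  assert (Thr := threshold_gt g M C HM (C_gt0 _ _ _ _ _ _ CP)).
  assert (Hg := Rabs_pos g).
  exists (threshold g M C + M), e; split; [lra|split; [apply (window _ _ _ _ _ _ CP)|]].
  intros t0 z0 v0 Ht Hadm Hv.
  exact (closing_plates_unbounded (plates f1 f2) a e tstar M C g t0 z0 v0 CP Ht Hadm Hv).
Qed.
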